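(* Let $A$ be an abelian group, $L$ a loop with identity $\epsilon$, and $(P,Q)$ a loop cocycle, $P,Q:L\times L\to\mathrm{Aut}(A)$, such that $F(P,Q)$ is a strongly linear abelian extension of $A$ by $L$. Then $F(P,Q)$ has the inverse property if and only if $L$ has the inverse property and the equations $$P(\xi\eta,\eta^{-1})=P(\xi,\eta)^{-1},\qquad Q(\xi\eta,\eta^{-1})=P(\xi,\eta)^{-1}Q(\xi,\eta),$$ $$Q(\xi^{-1},\xi\eta)=Q(\xi,\eta)^{-1},\qquad P(\xi^{-1},\xi\eta)=Q(\xi,\eta)^{-1}P(\xi,\eta)$$ hold for all $\xi,\eta\in L$.
   Context: A loop is a set with a binary multiplication having a two-sided identity element such that all left and right translations are bijections. A loop $L$ has the left (resp. right) inverse property if there is a bijection $\iota:L\to L$ with $\iota(x)\cdot xy=y$ (resp. $yx\cdot\iota(x)=y$) for all $x,y\in L$; then left and right inverses of every $x$ coincide and $\iota(x)=x^{-1}$. It has the inverse property if it has both. Let $A=(A,+)$ be a commutative group and $L$ a loop with identity $\epsilon$. A loop cocycle is a pair $(P,Q)$ of maps $P,Q:L\times L\to\mathrm{Aut}(A)$ with $P(\alpha,\epsilon)=\mathrm{Id}=Q(\epsilon,\beta)$ for all $\alpha,\beta\in L$. The linear abelian extension $F(P,Q)$ of $A$ by $L$ is the loop on $L\times A$ with multiplication $(\alpha,a)\cdot(\beta,b)=(\alpha\beta,\,P(\alpha,\beta)a+Q(\alpha,\beta)b)$ and identity $(\epsilon,0)$. It is called strongly linear abelian if $(\epsilon,a)\cdot(\beta,b)=(\beta,b)\cdot(\epsilon,a)=(\beta,a+b)$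 for all $a,b\in A$, $\beta\in L$; equivalently $P(\xi,\epsilon)=P(\epsilon,\xi)=\mathrm{Id}=Q(\xi,\epsilon)=Q(\epsilon,\xi)$ for all $\xi\in L$. *)

(* Defs.v *)
From HB Require Import structures.
From mathcomp Require Import all_boot all_algebra.

Set Implicit Arguments.
Unset Strict Implicit.
Unset Printing Implicit Defensive.

Import GRing.Theory.
Local Open Scope ring_scope.

HB.mixin Record UMagma_isLoop L of UMagma L := {
  mulg_bij : forall x : L, bijective (fun y : L => (x * y)%g);
  mulgr_bij : forall x : L, bijective (fun y : L => (y * x)%g)
}.

#[short(type="loopType")]
HB.structure Definition Loop := {L of UMagma_isLoop L & UMagma L}.

Bind Scope group_scope with Loop.sort.

Definition left_inverse_property (L : loopType) : Prop :=
  exists2 iota : L -> L, bijective iota & forall x y : L, (iota x * (x * y) = y)%g.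

Definition right_inverse_property (L : loopType) : Prop :=
  exists2 iota : L -> L, bijective iota & forall x y : L, ((y * x) * iota x = y)%g.

Definition inverse_property (L : loopType) : Prop :=
  left_inverse_property L /\ right_inverse_property L.

Lemma loop_inv_subproof (L : loopType) (x : L) : exists y : L, (x * y == 1)%g.
Proof. by have [g _ gK] := mulg_bij x; exists (g 1%g); apply/eqP/gK. Qed.

(* In a general loop this is the right inverse of x; the lemmas below show that
   it is the bijection iota as soon as the left or right inverse property
   holds, so that in those loops it is a two-sided inverse. *)
Definition loop_inv (L : loopType) (x : L) : L := xchoose (loop_inv_subproof x).

Lemma mul_loop_inv (L : loopType) (x : L) : (x * loop_inv x = 1)%g.
Proof. exact/eqP/(xchooseP (loop_inv_subproof x)). Qed.

Lemma loop_inv_lip (L : loopType) (iota : L -> L) :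
  (forall x y : L, (iota x * (x * y) = y)%g) -> @loop_inv L =1 iota.
Proof. by move=> iotaK x; rewrite -[LHS](iotaK x) mul_loop_inv mulg1. Qed.

Lemma loop_inv_rip (L : loopType) (iota : L -> L) :
  (forall x y : L, ((y * x) * iota x = y)%g) -> @loop_inv L =1 iota.
Proof.
move=> iotaK x; apply: (bij_inj (mulg_bij x)).
by rewrite mul_loop_inv -{1}(iotaK x 1%g) mul1g.
Qed.

Record aut (A : zmodType) := Aut {
  aut_fun :> {additive A -> A};
  aut_bij : bijective aut_fun
}.

Section AutInverse.
Variables (A : zmodType) (f : aut A).

Lemma aut_inv_subproof (a : A) : exists b : A, f b == a.
Proof. by have [g _ gK] := aut_bij f; exists (g a); apply/eqP. Qed.

Definition aut_inv_fun (a : A) : A := xchoose (aut_inv_subproof a).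

Lemma aut_inv_funK : cancel aut_inv_fun f.
Proof. by move=> a; apply/eqP/(xchooseP (aut_inv_subproof a)). Qed.

Lemma aut_funK : cancel f aut_inv_fun.
Proof. by move=> a; apply: (bij_inj (aut_bij f)); rewrite aut_inv_funK. Qed.

Lemma aut_inv_additive : zmod_morphism aut_inv_fun.
Proof. exact: can2_zmod_morphism aut_funK aut_inv_funK. Qed.

HB.instance Definition _ :=
  GRing.isZmodMorphism.Build A A aut_inv_fun aut_inv_additive.

Definition aut_inv : aut A :=
  @Aut A aut_inv_fun (Bijective aut_inv_funK aut_funK).

End AutInverse.

Definition loop_cocycle (A : zmodType) (L : loopType) (P Q : L -> L -> aut A) : Prop :=
  (forall x : L, P x 1%g =1 id) /\ (forall y : L, Q 1%g y =1 id).

(* F(P,Q); a separate name keeps this loop structure apart from other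
   structures on the product type. *)
Definition linear_extension (A : zmodType) (L : loopType) (P Q : L -> L -> aut A)
  (PQ : loop_cocycle P Q) : Type := (L * A)%type.

Section LinearExtension.
Variables (A : zmodType) (L : loopType) (P Q : L -> L -> aut A).
Variable PQ : loop_cocycle P Q.
Local Notation F := (linear_extension PQ).

HB.instance Definition _ := Choice.copy F (L * A)%type.

Definition linear_extension_mul (u v : F) : F :=
  ((u.1 * v.1)%g, P u.1 v.1 u.2 + Q u.1 v.1 v.2).

Definition linear_extension_one : F := (1%g, 0).

HB.instance Definition _ := hasMul.Build F linear_extension_mul.

Lemma linear_extension_mul1 : left_id linear_extension_one linear_extension_mul.
Proof.
by case=> y b; rewrite /linear_extension_mul /= mul1g raddf0 add0r PQ.2.
Qed.

Lemma linear_extension_mulr1 : right_id linear_extension_one linear_extension_mul.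
Proof.
by case=> x a; rewrite /linear_extension_mul /= mulg1 raddf0 addr0 PQ.1.
Qed.

HB.instance Definition _ := Magma_isUMagma.Build F
  linear_extension_mul1 linear_extension_mulr1.

Lemma linear_extension_mulg_bij (u : F) : bijective (fun v : F => (u * v)%g).
Proof.
case: u => x a; have [g gK Kg] := mulg_bij x.
exists (fun v : F => (g v.1, aut_inv (Q x (g v.1)) (v.2 - P x (g v.1) a)) : F).
  by case=> y b; congr (_, _); rewrite /= gK // addrC addKr aut_funK.
by case=> y b; congr (_, _); rewrite /= ?Kg // aut_inv_funK addrC subrK.
Qed.

Lemma linear_extension_mulgr_bij (u : F) : bijective (fun v : F => (v * u)%g).
Proof.
case: u => x a; have [g gK Kg] := mulgr_bij x.
exists (fun v : F => (g v.1, aut_inv (P (g v.1) x) (v.2 - Q (g v.1) x a)) : F).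
  by case=> y b; congr (_, _); rewrite /= gK // addrK aut_funK.
by case=> y b; congr (_, _); rewrite /= ?Kg // aut_inv_funK subrK.
Qed.

HB.instance Definition _ := UMagma_isLoop.Build F
  linear_extension_mulg_bij linear_extension_mulgr_bij.

Definition strongly_linear_abelian : Prop :=
  forall (a b : A) (y : L),
    (((1%g, a) : F) * ((y, b) : F) = ((y, a + b) : F))%g /\
    (((y, b) : F) * ((1%g, a) : F) = ((y, a + b) : F))%g.

End LinearExtension.

(* Main.v *)
Require Import Defs.
From mathcomp Require Import all_boot all_algebra.

(** The inverse of a loop element is determined by the multiplication, so each
    inverse property is an identity about [loop_inv]
    ([left_inverse_propertyE], [right_inverse_propertyE]).  In the extension,
    [(x, a)] always has the inverse
    [(x^-1, - Q(x, x^-1)^-1 (P(x, x^-1) a))] ([loop_inv_extension]).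

    The key point is that this inverse is just [(x^-1, - a)] on either side of
    the equivalence.  This is where strong linearity enters: it makes [P(1, x)]
    and [Q(x, 1)] trivial, and either the inverse property of the extension or
    the four equations then force [P(x, x^-1)] and [Q(x, x^-1)] to be trivial
    as well.

    Once the inverse is known, the right inverse property reads
    [(y x) x^-1 = y] in the first coordinate and
    [P(y x, x^-1) (P(y, x) b + Q(y, x) a) - Q(y x, x^-1) a = b] in the second.
    Since [a] and [b] vary independently, the latter splits into the first two
    equations ([affine_inverseP]).  The left inverse property has the same shape
    with the roles of [P] and [Q] exchanged, which gives the last two. *)

Set Implicit Arguments.
Unset Strict Implicit.
Unset Printing Implicit Defensive.

Import GRing.Theory.
Local Open Scope ring_scope.

(** At [y = 1] the identity gives [iota x * x = 1], so that for [iota x] and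
    [y = x] it gives [iota (iota x) = x]; bijectivity of [iota] is thus
    automatic. *)
Lemma left_inverse_involutive (L : loopType) (iota : L -> L) :
  (forall x y : L, (iota x * (x * y) = y)%g) -> involutive iota.
Proof.
move=> iotaK x; have iotaV : (iota x * x = 1)%g by rewrite -{2}(mulg1 x) iotaK.
by rewrite -{2}(iotaK (iota x) x) iotaV mulg1.
Qed.

Lemma right_inverse_involutive (L : loopType) (iota : L -> L) :
  (forall x y : L, ((y * x) * iota x = y)%g) -> involutive iota.
Proof.
move=> iotaK x; have iotaV : (x * iota x = 1)%g by rewrite -{1}(mul1g x) iotaK.
by rewrite -{2}(iotaK (iota x) x) iotaV mul1g.
Qed.

Lemma left_inverse_propertyE (L : loopType) :
  left_inverse_property L <-> forall x y : L, (loop_inv x * (x * y) = y)%g.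
Proof.
split=> [[iota _ iotaK] x y | invK]; first by rewrite (loop_inv_lip iotaK) iotaK.
by exists (@loop_inv L) => //; apply/inv_bij/left_inverse_involutive.
Qed.

Lemma right_inverse_propertyE (L : loopType) :
  right_inverse_property L <-> forall x y : L, ((y * x) * loop_inv x = y)%g.
Proof.
split=> [[iota _ iotaK] x y | invK]; first by rewrite (loop_inv_rip iotaK) iotaK.
by exists (@loop_inv L) => //; apply/inv_bij/right_inverse_involutive.
Qed.

(** The second coordinate of either inverse property in the extension has the
    form of the left-hand side, where [f], [v] are the values of the cocycle at
    the outer product and [g], [u] those at the inner one.  Taking [a = 0] and
    [b = 0] separates it into two conditions. *)
Lemma affine_inverseP (A : zmodType) (f g u v : aut A) :
  (forall a b, f (g b + u a) - v a = b) <->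
  f =1 aut_inv g /\ v =1 aut_inv g \o u.
Proof.
split=> [fgK | [fE vE] a b]; last first.
  by rewrite vE /= fE raddfD /= aut_funK addrK.
have fE : f =1 aut_inv g.
  move=> c; rewrite -{1}(aut_inv_funK g c).
  by move: (fgK 0 (aut_inv g c)); rewrite !raddf0 !addr0.
split=> // a; apply/esym/eqP; rewrite /= -fE -subr_eq0.
by move: (fgK a 0); rewrite raddf0 add0r => ->.
Qed.

Section Extension.
Variables (A : zmodType) (L : loopType) (P Q : L -> L -> aut A).
Variable PQ : loop_cocycle P Q.
Local Notation F := (linear_extension PQ).

Lemma linear_extension_mulE (x y : L) (a b : A) :
  (((x, a) : F) * ((y, b) : F))%g = ((x * y)%g, P x y a + Q x y b).
Proof. by []. Qed.

Lemma loop_inv_extension (x : L) (a : A) :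
  loop_inv ((x, a) : F) =
  (loop_inv x, - aut_inv (Q x (loop_inv x)) (P x (loop_inv x) a)).
Proof.
apply: (bij_inj (mulg_bij ((x, a) : F))); rewrite mul_loop_inv.
by rewrite linear_extension_mulE mul_loop_inv raddfN aut_inv_funK subrr.
Qed.

Lemma loop_inv_extension0 (x : L) : loop_inv ((x, 0) : F) = (loop_inv x, 0).
Proof. by rewrite loop_inv_extension !raddf0. Qed.

Hypothesis sPQ : strongly_linear_abelian PQ.

Lemma strongly_linear_P1 (x : L) : P 1%g x =1 id.
Proof.
move=> a; have [/(congr1 snd)] := sPQ a 0 x.
by rewrite linear_extension_mulE /= raddf0 !addr0.
Qed.

Lemma strongly_linear_Q1 (x : L) : Q x 1%g =1 id.
Proof.
move=> a; have [_ /(congr1 snd)] := sPQ a 0 x.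
by rewrite linear_extension_mulE /= raddf0 add0r addr0.
Qed.

(** Right inversion of [(1, a) * (x, 0)] shows that [P(x, x^-1)] inverts
    [P(1, x) = id], and left inversion of [(x, 0) * (x^-1, a)] that [Q(x, x^-1)]
    is inverted by [Q(x^-1, 1) = id]. *)
Lemma inverse_property_cocycleV :
  inverse_property F ->
  forall x, P x (loop_inv x) =1 id /\ Q x (loop_inv x) =1 id.
Proof.
case=> /left_inverse_propertyE lipF /right_inverse_propertyE ripF x.
split=> a.
  have := ripF (x, 0) (1%g, a).
  rewrite loop_inv_extension0 !linear_extension_mulE !raddf0 !addr0 mul1g.
  by case=> _; rewrite strongly_linear_P1.
have := lipF (x, 0) (loop_inv x, a).
rewrite loop_inv_extension0 !linear_extension_mulE !raddf0 !add0r mul_loop_inv.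
by case=> _; rewrite strongly_linear_Q1.
Qed.

(** The equations at [(1, x)] express [P(x, x^-1)] and [Q(x, x^-1)] by [P(1, x)]
    and [Q(1, x)], which are both trivial. *)
Lemma equations_cocycleV :
  (forall x y : L, P (x * y)%g (loop_inv y) =1 aut_inv (P x y)) ->
  (forall x y : L, Q (x * y)%g (loop_inv y) =1 aut_inv (P x y) \o Q x y) ->
  forall x, P x (loop_inv x) =1 id /\ Q x (loop_inv x) =1 id.
Proof.
move=> eqP eqQ x.
have P1V a : aut_inv (P 1%g x) a = a.
  by rewrite -[LHS](strongly_linear_P1 x) aut_inv_funK.
by split=> a; rewrite -{1}(mul1g x) ?eqP ?eqQ /= P1V ?PQ.2.
Qed.

Lemma loop_inv_extensionN :
  (forall x, P x (loop_inv x) =1 id /\ Q x (loop_inv x) =1 id) ->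
  forall x a, loop_inv ((x, a) : F) = (loop_inv x, - a).
Proof.
move=> PQV x a; have [PV QV] := PQV x.
by rewrite loop_inv_extension PV -[aut_inv _ a]QV aut_inv_funK.
Qed.

Hypothesis invE : forall x a, loop_inv ((x, a) : F) = (loop_inv x, - a).

Lemma right_inverse_property_extension :
  right_inverse_property F <->
  right_inverse_property L /\
  forall x y : L, P (x * y)%g (loop_inv y) =1 aut_inv (P x y) /\
                  Q (x * y)%g (loop_inv y) =1 aut_inv (P x y) \o Q x y.
Proof.
split=> [/right_inverse_propertyE ripF | [/right_inverse_propertyE ripL eqPQ]].
  split=> [|x y].
    apply/right_inverse_propertyE => y x.
    by have := ripF (y, 0) (x, 0); rewrite invE !linear_extension_mulE => -[].
  apply/affine_inverseP => a b; have := ripF (y, a) (x, b).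
  by rewrite invE !linear_extension_mulE raddfN => -[].
apply/right_inverse_propertyE => -[y a] [x b].
rewrite invE !linear_extension_mulE ripL raddfN.
by have /affine_inverseP-> := eqPQ x y.
Qed.

Lemma left_inverse_property_extension :
  left_inverse_property F <->
  left_inverse_property L /\
  forall x y : L, Q (loop_inv x) (x * y)%g =1 aut_inv (Q x y) /\
                  P (loop_inv x) (x * y)%g =1 aut_inv (Q x y) \o P x y.
Proof.
split=> [/left_inverse_propertyE lipF | [/left_inverse_propertyE lipL eqQP]].
  split=> [|x y].
    apply/left_inverse_propertyE => x y.
    by have := lipF (x, 0) (y, 0); rewrite invE !linear_extension_mulE => -[].
  apply/affine_inverseP => a b; have := lipF (x, a) (y, b).
  rewrite invE !linear_extension_mulE raddfN => -[_].
  by rewrite addrC [P x y a + _]addrC.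
apply/left_inverse_propertyE => -[x a] [y b].
rewrite invE !linear_extension_mulE lipL raddfN addrC [P x y a + _]addrC.
by have /affine_inverseP-> := eqQP x y.
Qed.

End Extension.

Theorem proposition9 (A : zmodType) (L : loopType) (P Q : L -> L -> aut A)
    (PQ : loop_cocycle P Q) (sPQ : strongly_linear_abelian PQ) :
  inverse_property (linear_extension PQ) <->
  inverse_property L /\
  forall x y : L,
    [/\ P (x * y)%g (loop_inv y) =1 aut_inv (P x y),
        Q (x * y)%g (loop_inv y) =1 aut_inv (P x y) \o Q x y,
        Q (loop_inv x) (x * y)%g =1 aut_inv (Q x y)
      & P (loop_inv x) (x * y)%g =1 aut_inv (Q x y) \o P x y].
Proof.
split=> [ipF | [[lipL ripL] eqs]].
  have invE := loop_inv_extensionN PQ (inverse_property_cocycleV sPQ ipF).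
  case: ipF => /(left_inverse_property_extension invE)[lipL eqQP].
  case/(right_inverse_property_extension invE)=> ripL eqPQ.
  by split=> // x y; have [? ?] := eqQP x y; have [? ?] := eqPQ x y.
have PQV : forall x, P x (loop_inv x) =1 id /\ Q x (loop_inv x) =1 id.
  by apply: (equations_cocycleV sPQ) => x y; have [] := eqs x y.
have invE := loop_inv_extensionN PQ PQV.
split.
  apply/(left_inverse_property_extension invE).
  by split=> // x y; have [] := eqs x y.
apply/(right_inverse_property_extension invE).
by split=> // x y; have [] := eqs x y.
Qed.
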